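(* The Killing-max property holds for the root system $A_n$: for all $\lambda,Y\in\overline{\mathfrak a^+}$ and all $w\in W$, $$\langle\lambda,w\cdot Y\rangle=\langle\lambda,Y\rangle\iff w\in W_\lambda\,W_Y .$$
   Context: For the root system $A_n$ ($n\ge1$): $\mathfrak a=\{x\in\mathbb R^{n+1}:\sum_i x_i=0\}$, $W=S_{n+1}$ acts by permuting the entries, $\overline{\mathfrak a^+}=\{x\in\mathfrak a:x_1\ge x_2\ge\dots\ge x_{n+1}\}$ is the closed positive Weyl chamber, and $\langle\cdot,\cdot\rangle$ is the $W$-invariant scalar product (the Killing form, a positive multiple of the standard scalar product). For $X\in\mathfrak a$, $W_X=\{w\in W:w\cdot X=X\}$; $W_\lambda W_Y=\{uv:u\in W_\lambda,v\in W_Y\}$. *)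

(* Defs.v *)
From HB Require Import structures.
From mathcomp Require Import all_boot all_order all_algebra all_fingroup.
From mathcomp Require Import reals.
Set Implicit Arguments.
Unset Strict Implicit.
Unset Printing Implicit Defensive.
Import Order.TTheory GRing.Theory Num.Theory.
Local Open Scope ring_scope.

(* The root system A_n lives in R^(n+1); its rank n is the explicit index. *)

Definition cartan (R : realType) (n : nat) (X : 'rV[R]_n.+1) : Prop :=
  \sum_(i < n.+1) X ord0 i = 0.

Definition closed_chamber (R : realType) (n : nat) (X : 'rV[R]_n.+1) : Prop :=
  cartan X /\ forall i j : 'I_n.+1, (i <= j)%N -> X ord0 j <= X ord0 i.

(* The Weyl group is 'S_n.+1.  The product s * t in 'S_n.+1 applies s first,
   so it is (w . X)_i = X_(w i), and not X_(w^-1 i), that gives a left action: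
   (s * t) . X = s . (t . X). *)
Definition weyl_act (R : realType) (n : nat) (w : 'S_n.+1) (X : 'rV[R]_n.+1)
  : 'rV[R]_n.+1 := col_perm w X.

Lemma weyl_act1 (R : realType) (n : nat) (X : 'rV[R]_n.+1) :
  weyl_act 1%g X = X.
Proof. exact: col_perm1. Qed.

Lemma weyl_actM (R : realType) (n : nat) (s t : 'S_n.+1) (X : 'rV[R]_n.+1) :
  weyl_act (s * t)%g X = weyl_act s (weyl_act t X).
Proof. exact: col_permM. Qed.

Lemma weyl_act_cartan (R : realType) (n : nat) (w : 'S_n.+1)
  (X : 'rV[R]_n.+1) : cartan X -> cartan (weyl_act w X).
Proof.
rewrite /cartan => hX; rewrite -[RHS]hX [RHS](reindex_inj (@perm_inj _ w)) /=.
by apply: eq_bigr => i _; rewrite mxE.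
Qed.

Definition weyl_stab (R : realType) (n : nat) (X : 'rV[R]_n.+1)
  : {set 'S_n.+1} := [set w : 'S_n.+1 | weyl_act w X == X].

(* The Killing form restricted to the Cartan subspace is this form for some
   c > 0 depending on the normalisation (for sl_(n+1)(R), c = 2(n+1)). *)
Definition killing_form (R : realType) (n : nat) (c : R) (X Y : 'rV[R]_n.+1)
  : R := c * \sum_(i < n.+1) X ord0 i * Y ord0 i.

Lemma killing_form_invariant (R : realType) (n : nat) (c : R) (w : 'S_n.+1)
  (X Y : 'rV[R]_n.+1) :
  killing_form c (weyl_act w X) (weyl_act w Y) = killing_form c X Y.
Proof.
rewrite /killing_form; congr (_ * _).
rewrite [RHS](reindex_inj (@perm_inj _ w)) /=.
by apply: eq_bigr => i _; rewrite !mxE.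
Qed.

(* Main.v *)
(* Start from w . Y and swap pairs of entries that are in the wrong order.  A
   swap at positions with equal lambda-entries is an element of W_lambda, any
   other one strictly increases the pairing with lambda; so the permutation u
   sorting w . Y is in W_lambda unless the pairing has increased.  As w . Y
   sorted is Y, equality of the pairings gives u in W_lambda and u w in W_Y. *)
Require Import Defs.
From HB Require Import structures.
From mathcomp Require Import all_boot all_order all_algebra all_fingroup.
From mathcomp Require Import reals.
From mathcomp Require Import ring.
Set Implicit Arguments.
Unset Strict Implicit.
Unset Printing Implicit Defensive.
Import Order.TTheory GRing.Theory Num.Theory.
Local Open Scope ring_scope.

Definition row_nonincreasing (R : realType) (n : nat) (X : 'rV[R]_n.+1) : Prop :=
  forall i j : 'I_n.+1, (i <= j)%N -> X ord0 j <= X ord0 i.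

(** Only the terms at [i] and [j] change. The sign of the product decides whether a swap raises the
    pairing. *)
Lemma killing_form_tperm (R : realType) (n : nat) (c : R)
  (X Z : 'rV[R]_n.+1) (i j : 'I_n.+1) : i != j ->
  killing_form c X (weyl_act (tperm i j) Z) - killing_form c X Z
  = c * ((X ord0 i - X ord0 j) * (Z ord0 j - Z ord0 i)).
Proof.
move=> ij; rewrite /killing_form -mulrBr -sumrB; congr (_ * _).
have ji : j != i by rewrite eq_sym.
rewrite (bigD1 i) //= (bigD1 j) //= big1 => [|k /andP[ki kj]].
  by rewrite !mxE tpermL tpermR; ring.
by rewrite !mxE tpermD 1?eq_sym // subrr.
Qed.

Lemma mem_weyl_stab (R : realType) (n : nat) (X : 'rV[R]_n.+1) (w : 'S_n.+1) :
  (w \in weyl_stab X) = (weyl_act w X == X).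
Proof. by rewrite inE. Qed.

Lemma killing_form_stab (R : realType) (n : nat) (c : R) (X Z : 'rV[R]_n.+1)
  (u : 'S_n.+1) : u \in weyl_stab X ->
  killing_form c X (weyl_act u Z) = killing_form c X Z.
Proof.
rewrite mem_weyl_stab => /eqP uX.
by rewrite -{1}uX killing_form_invariant.
Qed.

Lemma weyl_stabM (R : realType) (n : nat) (X : 'rV[R]_n.+1) (u v : 'S_n.+1) :
  u \in weyl_stab X -> v \in weyl_stab X -> (u * v)%g \in weyl_stab X.
Proof.
by rewrite !mem_weyl_stab weyl_actM => /eqP uX /eqP ->; rewrite uX.
Qed.

Lemma weyl_stabV (R : realType) (n : nat) (X : 'rV[R]_n.+1) (u : 'S_n.+1) :
  u \in weyl_stab X -> (u^-1)%g \in weyl_stab X.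
Proof.
by rewrite !mem_weyl_stab => /eqP uX; rewrite -{1}uX -weyl_actM mulVg weyl_act1.
Qed.

Lemma weyl_stab_tperm (R : realType) (n : nat) (X : 'rV[R]_n.+1)
  (i j : 'I_n.+1) : X ord0 i = X ord0 j -> tperm i j \in weyl_stab X.
Proof.
move=> Xij; rewrite mem_weyl_stab; apply/eqP/rowP => k.
by rewrite mxE; case: tpermP => [->|->|].
Qed.

(** Instead of an induction on swaps, [u] is chosen extremal among the permutations satisfying the
    disjunction. A swap of a wrongly ordered pair stays in this set, contradicting extremality. *)
Lemma weyl_sort (R : realType) (n : nat) (c : R) (lambda Z : 'rV[R]_n.+1) :
  0 < c -> row_nonincreasing lambda ->
  exists u : 'S_n.+1, row_nonincreasing (weyl_act u Z) /\
    (u \in weyl_stab lambda \/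
     killing_form c lambda Z < killing_form c lambda (weyl_act u Z)).
Proof.
move=> c0 hl.
(* Up to a constant shift this is the Weyl vector. Being strictly decreasing, it detects wrong pairs
   even where [lambda] has ties. *)
pose rho : 'rV[R]_n.+1 := \row_i - (i%:R).
pose P := [pred u : 'S_n.+1 | (u \in weyl_stab lambda) ||
  (killing_form c lambda Z < killing_form c lambda (weyl_act u Z))].
have P1 : P 1%g by rewrite /= mem_weyl_stab weyl_act1 eqxx.
(* Maximality against the strictly decreasing rho forces u . Z to be sorted. *)
case: (Order.TotalTheory.arg_maxP (fun u => killing_form c rho (weyl_act u Z)) P1)
  => u Pu umax.
exists u; split; last exact/orP.
move=> i j; rewrite leq_eqVlt => /orP[/eqP/val_inj-> //|ij].
rewrite leNgt; apply/negP => uij.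
have nij : i != j by rewrite -val_eqE /= ltn_eqF.
have rho_incr : killing_form c rho (weyl_act u Z)
    < killing_form c rho (weyl_act (tperm i j * u)%g Z).
  rewrite weyl_actM -subr_gt0 killing_form_tperm // mulr_gt0 // mulr_gt0 //.
    by rewrite !mxE opprK addrC subr_gt0 ltr_nat.
  by rewrite subr_gt0.
suff Ptu : P (tperm i j * u)%g.
  by have := lt_le_trans rho_incr (umax _ Ptu); rewrite ltxx.
(* At a tie of [lambda] the swap fixes [lambda], so either alternative persists; otherwise the swap
   strictly raises the pairing with [lambda]. *)
have := hl _ _ (ltnW ij); rewrite le_eqVlt => /orP[/eqP lij|lij].
  have st := weyl_stab_tperm (esym lij).
  move/orP: Pu => [us|uZ]; apply/orP; first by left; apply: weyl_stabM.
  by right; rewrite weyl_actM killing_form_stab.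
apply/orP; right; rewrite weyl_actM.
apply: (@le_lt_trans _ _ (killing_form c lambda (weyl_act u Z))).
  by move/orP: Pu => [us|/ltW//]; rewrite killing_form_stab.
rewrite -subr_gt0 killing_form_tperm // mulr_gt0 // mulr_gt0 ?subr_gt0 //.
Qed.

Lemma row_nonincreasing_sorted (R : realType) (n : nat) (X : 'rV[R]_n.+1) :
  row_nonincreasing X -> sorted >=%O [seq X ord0 i | i <- enum 'I_n.+1].
Proof.
move=> hX; apply: (homo_sorted (e := fun i j : 'I_n.+1 => (i <= j)%N)).
  by move=> i j /hX.
by have := iota_sorted 0 n.+1; rewrite -val_enum_ord sorted_map.
Qed.

(** Both rows list the same multiset of entries in nonincreasing order, and such a listing is
    unique. *)
Lemma row_nonincreasing_weyl_fix (R : realType) (n : nat) (X : 'rV[R]_n.+1)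
  (v : 'S_n.+1) :
  row_nonincreasing X -> row_nonincreasing (weyl_act v X) -> weyl_act v X = X.
Proof.
move=> hX hvX.
have eq_entries : [seq weyl_act v X ord0 i | i <- enum 'I_n.+1]
    = [seq X ord0 i | i <- enum 'I_n.+1].
  apply: (sorted_eq (leT := >=%O)).
  - exact: ge_trans.
  - exact: ge_anti.
  - exact: row_nonincreasing_sorted.
  - exact: row_nonincreasing_sorted.
  rewrite (eq_map (g := (fun i => X ord0 i) \o v)); last by move=> i; rewrite mxE.
  rewrite map_comp; apply/perm_map/uniq_perm.
  - by rewrite (map_inj_uniq (@perm_inj _ v)) enum_uniq.
  - exact: enum_uniq.
  move=> i; rewrite mem_enum; apply/mapP; exists (v^-1 i)%g.
    by rewrite mem_enum.
  by rewrite permKV.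
apply/rowP => i.
by have /eq_in_map/(_ i) := eq_entries; apply; rewrite mem_enum.
Qed.

Theorem corollaryA5 (R : realType) (n : nat) (hn : (1 <= n)%N)
  (c : R) (hc : 0 < c)
  (lambda Y : 'rV[R]_n.+1)
  (hlambda : closed_chamber lambda) (hY : closed_chamber Y) (w : 'S_n.+1) :
  killing_form c lambda (weyl_act w Y) = killing_form c lambda Y
  <-> w \in (weyl_stab lambda * weyl_stab Y)%g.
Proof.
case: hlambda hY => _ hl [_ hY]; split=> [wE|/mulsgP[u v us]].
  have [u [hu us]] := weyl_sort (weyl_act w Y) hc hl.
  rewrite -weyl_actM in hu us.
  have uwY := row_nonincreasing_weyl_fix hY hu.
  (* Since [u * w] fixes [Y], the strict alternative would put the pairing of [lambda] and [Y] below
     itself. *)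
  case: us => [us|]; last by rewrite uwY wE ltxx.
  apply/mulsgP; exists (u^-1)%g (u * w)%g; last by rewrite mulKg.
    exact: weyl_stabV.
  by rewrite mem_weyl_stab uwY.
(* Conversely, [Y] absorbs [v], and invariance of the form lets [lambda] absorb [u]. *)
rewrite mem_weyl_stab => /eqP vY ->.
by rewrite weyl_actM vY killing_form_stab.
Qed.
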